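(* Let $\alpha\in(0,1)$ be fixed, and consider a sequence of problems indexed by the sample size $n\to\infty$ (with $d$, $\mathcal G_1$, $\mathcal H$, $\theta>0$ allowed to depend on $n$), where $\mathcal G_1$ is a nonempty class of graphs on $\overline V=\{1,\dots,d\}$ not containing the empty graph, $\mathcal R=\min_{G\in\mathcal G_1}\mathcal R(G)$ is the minimal arboricity, and $\mathcal H$ is a witnessing set of $\mathcal G_1$. Suppose that $\log(|\mathcal H|)/n=o(1)$ and $|\mathcal H|\ge2/\alpha$. Let $M(\mathcal H)=\log(|\mathcal H|)/m(\mathcal H)$ with $m(\mathcal H)=\min_{H\in\mathcal H}|V(H)|$. If $$\theta>\kappa\sqrt{\frac{M(\mathcal H)}{\mathcal R n}}$$ for a large enough absolute constant $\kappa$, then when $n$ is large enough the test (with the same $\kappa$) $$\psi=\mathbf 1\Big[\max_{H\in\mathcal H}\widehat W_H>\frac{\kappa}{4}\sqrt{\frac{M(\mathcal H)}{\mathcal R n}}\Big],\qquad \widehat W_H=\frac1n\sum_{l=1}^n\Big(\frac1{|E(H)|}\sum_{(i,j)\in E(H)}X_{l,i}X_{l,j}\Big),$$ based on i.i.d. samples $X_1,\dots,X_n\in\{\pm1\}^d$ (with $X_{l,i}$ the $i$-th component of $X_l$), satisfies $$\mathbb P_{0,n}(\psi=1)+\max_{\Theta\in\mathcal S(\mathcal G_1,\theta)}\mathbb P_{\Theta,n}(\psi=0)\le\alpha.$$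
   Context: Graphs are simple undirected graphs on $\overline V=\{1,\dots,d\}$; $E(G)$ is the set of (undirected) edges and $V(G)$ the set of non-isolated vertices of $G$. A subgraph of $(\overline V,E)$ is a graph $(\overline V,E')$ with $E'\subseteq E$. Arboricity: $\mathcal R(G)=\big\lceil\max_{V\subseteq\overline V}\frac{|E(G_V)|}{|V|-1}\big\rceil$, where $G_V$ is obtained from $G$ by removing all edges having an endpoint outside $V$, and $0/0:=0$. Witnessing subgraph: for $G\in\mathcal G_1$, a graph $H$ is a witnessing subgraph of $G$ with respect to $\mathcal G_1$ if $H$ is a subgraph of $G$ and $\lceil|E(H)|/(|V(H)|-1)\rceil\ge\mathcal R$. Witnessing set: a collection $\mathcal H$ of graphs is a witnessing set of $\mathcal G_1$ if for every $G\in\mathcal G_1$ there exists $H\in\mathcal H$ such that $H$ is a witnessing subgraph of $G$. Zero-field ferromagnetic Ising model: for a symmetric $\Theta=(\theta_{ij})\in\mathbb R^{d\times d}$ with zero diagonal and nonnegative entries, $\mathbb P_\Theta(X)=\frac1{Z_\Theta}\exp\big(\sum_{i,j=1}^d\theta_{ij}X_iX_j\big)$ on $\{\pm1\}^d$, where $Z_\Theta$ is the normalizing constant (the sum runs over all ordered pairs $(i,j)$). $G(\Theta)$ is the graph with edges $\{(i,j):\theta_{ij}\ne0\}$. $\mathbb P_{\Theta,n}$ is the joint law of $n$ i.i.d. samples; $\mathbb P_{0,n}$ is the case $\Theta=0$. $\mathcal S(\mathcal G_1,\theta)=\{\Theta:\Theta=\Theta^T,\ \Theta\text{ has zero diagonal},\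 G(\Theta)\in\mathcal G_1,\ \|\Theta\|_F\le1/2,\ \min_{(i,j)\in E[G(\Theta)]}\theta_{ij}\ge\theta\}$, with $\|\cdot\|_F$ the Frobenius norm.
   Formalization: The formal statement additionally requires every H in the witnessing set (not only those serving some G) to satisfy ⌈|E(H)|/(|V(H)|−1)⌉ ≥ R; without this the claim fails, e.g. for G1={K_d} and H consisting of K_d and all single-edge graphs. *)

(* Defs.v *)
From HB Require Import structures.
From mathcomp Require Import all_boot all_order all_algebra.
From mathcomp Require Import all_classical all_reals all_analysis.

Set Implicit Arguments.
Unset Strict Implicit.
Unset Printing Implicit Defensive.

Import Order.TTheory GRing.Theory Num.Theory.

Local Open Scope ring_scope.

(* A simple undirected graph on 'I_d is its set of edges, an edge being a
   two-element set of vertices.  The vertex set of the paper, {1, ..., d}, is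
   rendered as 'I_d. *)
Record sgraph (d : nat) := SGraph {
  edges : {set {set 'I_d}};
  _ : [forall e in edges, #|e| == 2]
}.

HB.instance Definition _ (d : nat) := [isSub for @edges d].
HB.instance Definition _ (d : nat) := [Finite of sgraph d by <:].

Section Graphs.
Variable d : nat.
Implicit Types (G H : sgraph d) (V : {set 'I_d}).

Fact empty_graph_subproof :
  [forall e in (finset.set0 : {set {set 'I_d}}), #|e| == 2].
Proof. by apply/forall_inP => e; rewrite finset.in_set0. Qed.

Definition empty_graph : sgraph d := SGraph empty_graph_subproof.

(* The set V(G) of non-isolated vertices. *)
Definition vertices G : {set 'I_d} := finset.cover (edges G).

Definition subgraph H G : bool := edges H \subset edges G.

(* The edge set of G_V. *)
Definition edges_in G V : {set {set 'I_d}} :=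
  [set e in edges G | e \subset V]%SET.

(* |E| / (|V| - 1), where the subtraction is not truncated; 0 / 0 = 0. *)
Definition density (E V : nat) : rat := E%:R / (V%:R - 1).

(* The default value 0 of the maximum is also the value at V = set0, and the
   ceiling is nonnegative, so absz is only a cast from int to nat. *)
Definition arboricity G : nat :=
  absz (Num.ceil (\big[Num.max/0]_(V : {set 'I_d})
                    density #|edges_in G V| #|V|)).

Definition ceil_density H : nat :=
  absz (Num.ceil (density #|edges H| #|vertices H|)).

End Graphs.

(* The minimum of f over A.  The default value is the maximum of f over A, so
   that it does not affect the result when A is nonempty. *)
Definition min_over (T : finType) (A : {set T}) (f : T -> nat) : nat :=
  \big[minn/ (\max_(x in A) f x)%N]_(x in A) f x.

Definition min_arboricity (d : nat) (G1 : {set sgraph d}) : nat :=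
  min_over G1 (@arboricity d).

Definition witnessing_subgraph (d : nat) (G1 : {set sgraph d})
    (G H : sgraph d) : Prop :=
  subgraph H G /\ (min_arboricity G1 <= ceil_density H)%N.

(* This does not constrain the members of HH that serve no graph of G1. *)
Definition witnessing_set (d : nat) (G1 HH : {set sgraph d}) : Prop :=
  forall G, G \in G1 -> exists2 H, H \in HH & witnessing_subgraph G1 G H.

Definition min_vertices (d : nat) (HH : {set sgraph d}) : nat :=
  min_over HH (fun H => #|vertices H|).

Section Ising.
Variable R : realType.

(* M(H) = log |H| / m(H) *)
Definition witness_entropy (d : nat) (HH : {set sgraph d}) : R :=
  ln #|HH|%:R / (min_vertices HH)%:R.

(* Configurations are encoded by booleans, read as spins in {+1, -1}. *)
Definition config (d : nat) : finType := {ffun 'I_d -> bool}.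

Definition spin (d : nat) (x : config d) (i : 'I_d) : R :=
  if x i then 1 else -1.

Definition ising_weight (d : nat) (Theta : 'M[R]_d) (x : config d) : R :=
  expR (\sum_i \sum_j Theta i j * spin x i * spin x j).

Definition partition_function (d : nat) (Theta : 'M[R]_d) : R :=
  \sum_(x : config d) ising_weight Theta x.

Definition ising (d : nat) (Theta : 'M[R]_d) (x : config d) : R :=
  ising_weight Theta x / partition_function Theta.

(* n samples X_1, ..., X_n; X l is the l-th one. *)
Definition samples (d n : nat) : finType := {ffun 'I_n -> config d}.

(* Probability of an event under the law of n i.i.d. samples. *)
Definition prob (d n : nat) (Theta : 'M[R]_d) (A : pred (samples d n)) : R :=
  \sum_(X : samples d n | A X) \prod_(l < n) ising Theta (X l).

(* The edge set of G(Theta).  The condition i != j makes it a simple graph for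
   every matrix; it is implied by theta_ij != 0 when the diagonal is zero. *)
Definition support_edges (d : nat) (Theta : 'M[R]_d) : {set {set 'I_d}} :=
  [set [set p.1; p.2]%SET | p : 'I_d * 'I_d
     & (p.1 != p.2) && (Theta p.1 p.2 != 0)]%SET.

Fact support_subproof (d : nat) (Theta : 'M[R]_d) :
  [forall e in support_edges Theta, #|e| == 2].
Proof.
apply/forall_inP => e /imsetP[p]; rewrite inE => /andP[neq _] ->.
by rewrite cards2 neq.
Qed.

Definition support_graph (d : nat) (Theta : 'M[R]_d) : sgraph d :=
  SGraph (support_subproof Theta).

Definition frobenius (d : nat) (Theta : 'M[R]_d) : R :=
  Num.sqrt (\sum_i \sum_j Theta i j ^+ 2).

(* The class S(G1, theta). *)
Definition ising_class (d : nat) (G1 : {set sgraph d}) (theta : R) :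
    set 'M[R]_d :=
  [set Theta : 'M[R]_d |
    [/\ Theta^T = Theta,
        forall i, Theta i i = 0,
        support_graph Theta \in G1,
        frobenius Theta <= 1 / 2 &
        forall i j, [set i; j]%SET \in edges (support_graph Theta) ->
          theta <= Theta i j]]%classic.

(* sqrt (M(H) / (R n)) *)
Definition signal_level (d n : nat) (G1 HH : {set sgraph d}) : R :=
  Num.sqrt (witness_entropy HH / ((min_arboricity G1)%:R * n%:R)).

(* The product over an edge e = {i, j} is X_i X_j. *)
Definition W_stat (d n : nat) (H : sgraph d) (X : samples d n) : R :=
  n%:R^-1 * \sum_(l < n)
    (#|edges H|%:R^-1 * \sum_(e in edges H) \prod_(i in e) spin (X l) i).

(* W_stat takes values in [-1, 1], so the default value -1 does not affect the
   maximum. *)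
Definition witness_test (d n : nat) (kappa : R) (G1 HH : {set sgraph d})
    (X : samples d n) : bool :=
  kappa / 4 * signal_level n G1 HH < \big[Num.max/-1]_(H in HH) W_stat H X.

(* The supremum is the maximum in the paper (ising_class G1 theta is compact
   when 0 < theta); over an empty class it is 0. *)
Definition witness_risk (d n : nat) (kappa theta : R)
    (G1 HH : {set sgraph d}) : R :=
  prob 0 (@witness_test d n kappa G1 HH)
  + sup ((fun Theta => prob Theta (fun X => ~~ @witness_test d n kappa G1 HH X))
           @` ising_class G1 theta)%classic.

End Ising.

(* Main.v *)
(** Every member H of HH has 4 |E(H)| >= R |V(H)| edges, so both errors reduce to
    Chernoff bounds for the edge sum of H, followed by a union bound over HH.

    Under Theta = 0, integrating out the spins one at a time with
    cosh a <= exp (2 a^2) gives E exp (u sum_e x_e) <= exp (4 u^2 |E(H)|) for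
    small u^2 |E(H)|; take u^2 = log |HH| / (n |E(H)|), which is small because
    log |HH| / n tends to 0.

    Under Theta in the class, E exp (- theta sum_e x_e) is a ratio of partition
    functions, Z(Theta') / Z(Theta), where Theta' lowers the couplings on H by
    theta / 2. By Jensen it is at most exp (- theta E_Theta' (sum_e x_e)), and
    Griffiths' first inequality bounds every edge correlation under Theta',
    which is still ferromagnetic, below by theta / 2. *)

Require Import Defs.
From mathcomp Require Import all_boot all_order all_algebra.
From mathcomp Require Import all_classical all_reals all_analysis.
From mathcomp Require Import ring lra zify.

Set Implicit Arguments.
Unset Strict Implicit.
Unset Printing Implicit Defensive.

Import Order.TTheory GRing.Theory Num.Theory.
Import numFieldNormedType.Exports.

Local Open Scope ring_scope.

(** * Partition functions of small coupling matrices *)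

(** For [a >= 1/2] both exponentials are below [expR (2 * a ^+ 2)], since [a <= 2 a^2]. For smaller
    [a], the bound [expR b <= 1 / (1 - b)] reduces the claim to [2 / (1 - a^2) <= 2 (1 + 2 a^2)]. *)
Lemma cosh_le_expR (R : realType) (a : R) :
  expR a + expR (- a) <= 2 * expR (2 * a ^+ 2).
Proof.
wlog a0 : a / 0 <= a => [W|].
  case: (leP 0 a) => [/W//|/ltW a0].
  by have := W (- a); rewrite opprK sqrrN addrC; apply; rewrite oppr_ge0.
have [ha|ha] := leP (1 / 2) a.
  have h1 : expR a <= expR (2 * a ^+ 2) by rewrite ler_expR; nra.
  have h2 : expR (- a) <= expR (2 * a ^+ 2) by rewrite ler_expR; nra.
  by lra.
have inv (b : R) : b < 1 -> expR b <= (1 - b)^-1.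
  move=> b1; rewrite -[b in expR b]opprK expRN lef_pV2 ?posrE ?expR_gt0 //.
    exact: expR_ge1Dx.
  by rewrite subr_gt0.
have h1 : expR a <= (1 - a)^-1 by apply: inv; lra.
have h2 : expR (- a) <= (1 + a)^-1.
  by rewrite -[a in leRHS]opprK; apply: inv; lra.
have h3 : 1 + 2 * a ^+ 2 <= expR (2 * a ^+ 2) by exact: expR_ge1Dx.
have h4 : (1 - a)^-1 + (1 + a)^-1 <= 2 * (1 + 2 * a ^+ 2).
  have -> : (1 - a)^-1 + (1 + a)^-1 = 2 / (1 - a ^+ 2).
    by field; apply/and3P; split; apply: lt0r_neq0; nra.
  have a2 : a ^+ 2 <= 1 / 4 by nra.
  have a2' := sqr_ge0 a.
  rewrite ler_pdivrMr; last by lra.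
  by move: (a ^+ 2) a2 a2' => y; nra.
by lra.
Qed.

Definition energy (R : realType) (d : nat) (Theta : 'M[R]_d) (x : config d) : R :=
  \sum_i \sum_j Theta i j * spin R x i * spin R x j.

Definition norm2 (R : realType) (d : nat) (Theta : 'M[R]_d) : R :=
  \sum_i \sum_j Theta i j ^+ 2.

Definition flip (d : nat) (v : 'I_d) (x : config d) : config d :=
  [ffun i => if i == v then ~~ x i else x i].

Lemma flipK (d : nat) (v : 'I_d) : involutive (flip v).
Proof. by move=> x; apply/ffunP => i; rewrite !ffunE; case: eqP; rewrite ?negbK. Qed.

Lemma spin_flip (R : realType) (d : nat) (v : 'I_d) (x : config d) (i : 'I_d) :
  spin R (flip v x) i = (if i == v then -1 else 1) * spin R x i.
Proof.
by rewrite /spin ffunE; case: eqP => _; case: (x i); rewrite ?mulN1r ?opprK ?mul1r.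
Qed.

Lemma spin_sqr (R : realType) (d : nat) (x : config d) (i : 'I_d) :
  spin R x i * spin R x i = 1.
Proof. by rewrite /spin; case: (x i); rewrite ?mulrNN mulr1. Qed.

Lemma sum_off_vertex (R : realType) (d : nat) (v : 'I_d) (F : 'I_d -> 'I_d -> R) :
  (forall i j, F i j = F j i) -> F v v = 0 ->
  \sum_i \sum_j F i j =
    2 * (\sum_j F v j) + \sum_i \sum_j (if (i == v) || (j == v) then 0 else F i j).
Proof.
move=> Fsym Fv.
rewrite (bigD1 v) //= [X in _ = _ + X](bigD1 v) //= [X in _ + (X + _)]big1 => [|j _]; last first.
  by rewrite eqxx.
rewrite add0r mulr_natl mulr2n -addrA; congr (_ + _).
rewrite [X in _ = X + _](bigD1 v) //= Fv add0r -big_split /=.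
apply: eq_bigr => i /negPf iv.
rewrite (bigD1 v) //= [X in _ = _ + X](bigD1 v) //= eqxx orbT add0r Fsym.
by congr (_ + _); apply: eq_bigr => j /negPf jv; rewrite iv jv.
Qed.

(** The operator norm is at most the Frobenius norm. With [S] the sum of the [b i ^+ 2], expand the
    nonnegative sum of the squares of [S * p i j - rho * (b i * b j)] and divide by
    [2 * rho * S]. *)
Lemma sum_quad_le (R : realType) (I : finType) (p : I -> I -> R) (b : I -> R) (rho : R) :
  0 < rho -> \sum_i \sum_j p i j ^+ 2 <= rho ^+ 2 ->
  \sum_i \sum_j p i j * (b i * b j) <= rho * \sum_i b i ^+ 2.
Proof.
move=> rho0 hp; set S := \sum_i b i ^+ 2.
have S0 : 0 <= S by apply: sumr_ge0 => i _; exact: sqr_ge0.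
have [S_eq0|Sn0] := eqVneq S 0.
  have b0 i : b i = 0.
    move/eqP: S_eq0; rewrite psumr_eq0 => [/allP/(_ i)|i' _]; last exact: sqr_ge0.
    by rewrite mem_index_enum sqrf_eq0 => /(_ isT)/eqP.
  by rewrite S_eq0 mulr0 big1 // => i _; rewrite big1 // => j _; rewrite b0 mul0r mulr0.
have Sgt0 : 0 < S by rewrite lt_def Sn0.
have hb : \sum_i \sum_j (b i * b j) ^+ 2 = S ^+ 2.
  rewrite expr2 /S big_distrl /=; apply: eq_bigr => i _.
  by rewrite big_distrr /=; apply: eq_bigr => j _; rewrite exprMn.
clearbody S; have : 0 <= \sum_i \sum_j (S * p i j - rho * (b i * b j)) ^+ 2.
  by apply: sumr_ge0 => i _; apply: sumr_ge0 => j _; exact: sqr_ge0.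
have -> : \sum_i \sum_j (S * p i j - rho * (b i * b j)) ^+ 2 =
   S ^+ 2 * (\sum_i \sum_j p i j ^+ 2) - 2 * rho * S * (\sum_i \sum_j p i j * (b i * b j))
   + rho ^+ 2 * (\sum_i \sum_j (b i * b j) ^+ 2).
  rewrite !mulr_sumr -sumrB -big_split; apply: eq_bigr => i _ /=.
  rewrite !mulr_sumr -sumrB -big_split; apply: eq_bigr => j _ /=.
  by ring.
rewrite hb; set T := (\sum_i \sum_j p i j * _); set P := (\sum_i \sum_j p i j ^+ 2) in hp *.
move=> h.
have h1 : S ^+ 2 * P <= S ^+ 2 * rho ^+ 2 by rewrite ler_wpM2l // sqr_ge0.
have : (2 * rho * S) * T <= (2 * rho * S) * (rho * S) by lra.
by rewrite ler_pM2l // !mulr_gt0.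
Qed.

(* Integrating out the spin of v adds 8 b b^T, off the diagonal, to the matrix,
   where b is the row of v; for a small matrix this costs less Frobenius norm
   than the removal of the row and the column of v frees. *)
Lemma sum_weight_le_supp (R : realType) (d : nat) (s : seq 'I_d) (Theta : 'M[R]_d) :
  (forall i j, Theta i j = Theta j i) -> (forall i, Theta i i = 0) ->
  (forall i j, i \notin s -> Theta i j = 0) ->
  norm2 Theta <= 1 / 400 ->
  \sum_(x : config d) expR (energy Theta x) <= 2 ^+ d * expR (8 * norm2 Theta).
Proof.
elim: s Theta => [|v s IH] Theta Tsym Td Ts Tn.
  have T0 i j : Theta i j = 0 by exact: Ts.
  rewrite (eq_bigr (fun=> 1)) => [|x _]; last first.
    by rewrite /energy big1 ?expR0 // => i _; rewrite big1 // => j _; rewrite T0 !mul0r.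
  rewrite sumr_const card_ffun card_bool card_ord natrX.
  rewrite ler_peMr ?exprn_ge0 // -expR0 ler_expR mulr_ge0 //.
  by apply: sumr_ge0 => i _; apply: sumr_ge0 => j _; exact: sqr_ge0.
pose p i j := if (i == v) || (j == v) then 0 else Theta i j.
pose Theta' := \matrix_(i, j) (if i == j then 0 else p i j + 8 * (Theta v i * Theta v j)).
pose S := \sum_j Theta v j ^+ 2.
pose P := \sum_i \sum_j p i j ^+ 2.
have S0 : 0 <= S by apply: sumr_ge0 => i _; exact: sqr_ge0.
have P0 : 0 <= P by apply: sumr_ge0 => i _; apply: sumr_ge0 => j _; exact: sqr_ge0.
have nT : norm2 Theta = 2 * S + P.
  rewrite /norm2 (@sum_off_vertex _ _ v); last 2 first.
  - by move=> i j; rewrite Tsym.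
  - by rewrite Td expr0n.
  congr (_ + _); apply: eq_bigr => i _; apply: eq_bigr => j _.
  by rewrite /p; case: ifP => //; rewrite expr0n.
(* Since [norm2 Theta <= 1/400], the off-row part [p] has Frobenius norm at most 1/20 and
   [S <= 1/800]. The rank-one term thus adds at most [16/20 * S + 64 * S ^+ 2 <= S] to [P]. *)
have nT' : norm2 Theta' <= norm2 Theta - S.
  have hP : \sum_i \sum_j p i j * (Theta v i * Theta v j) <= 1 / 20 * S.
    by apply: sum_quad_le => //; rewrite -/P; lra.
  have hb : \sum_i \sum_j (Theta v i * Theta v j) ^+ 2 = S ^+ 2.
    rewrite expr2 /S big_distrl /=; apply: eq_bigr => i _.
    by rewrite big_distrr /=; apply: eq_bigr => j _; rewrite exprMn.
  have : norm2 Theta' <= \sum_i \sum_j (p i j + 8 * (Theta v i * Theta v j)) ^+ 2.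
    apply: ler_sum => i _; apply: ler_sum => j _; rewrite mxE.
    by case: ifP => // _; rewrite expr0n sqr_ge0.
  have -> : \sum_i \sum_j (p i j + 8 * (Theta v i * Theta v j)) ^+ 2 =
     P + 16 * (\sum_i \sum_j p i j * (Theta v i * Theta v j))
       + 64 * (\sum_i \sum_j (Theta v i * Theta v j) ^+ 2).
    rewrite /P !mulr_sumr -!big_split; apply: eq_bigr => i _ /=.
    rewrite !mulr_sumr -!big_split; apply: eq_bigr => j _ /=.
    by ring.
  by rewrite hb; nra.
(* Spins square to 1, so the diagonal of the rank-one term is worth the constant [8 * S], and
   [Theta'] can keep a zero diagonal. *)
have eT' x : 8 * S + energy Theta' x =
    \sum_i \sum_j p i j * spin R x i * spin R x j
      + 8 * (\sum_j Theta v j * spin R x j) ^+ 2.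
  have -> : S = \sum_i \sum_j (if i == j then Theta v i ^+ 2 else 0).
    by apply: eq_bigr => i _; rewrite -big_mkcond (big_pred1 i).
  rewrite /energy expr2 big_distrl !mulr_sumr -!big_split; apply: eq_bigr => i _ /=.
  rewrite big_distrr !mulr_sumr -!big_split; apply: eq_bigr => j _ /=.
  rewrite mxE; case: eqP => [<-|_]; last by ring.
  by rewrite /p Td if_same mulrACA spin_sqr; ring.
have eT x : energy Theta x =
    \sum_i \sum_j p i j * spin R x i * spin R x j
      + 2 * (spin R x v * \sum_j Theta v j * spin R x j).
  rewrite /energy (@sum_off_vertex _ _ v); last 2 first.
  - by move=> i j; rewrite Tsym; ring.
  - by rewrite Td !mul0r.
  rewrite addrC mulr_sumr; congr (_ + 2 * _); last by apply: eq_bigr => j _; ring.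
  apply: eq_bigr => i _; apply: eq_bigr => j _.
  by rewrite /p; case: ifP => //; rewrite !mul0r.
have flipE x : energy Theta (flip v x) =
    \sum_i \sum_j p i j * spin R x i * spin R x j
      - 2 * (spin R x v * \sum_j Theta v j * spin R x j).
  rewrite eT spin_flip eqxx !mulN1r mulNr mulrN; congr (_ + - (2 * (_ * _))).
    apply: eq_bigr => i _; apply: eq_bigr => j _.
    rewrite !spin_flip /p.
    by case: (i == v) => /=; [rewrite !mul0r|case: (j == v) => /=; rewrite ?mul0r ?mul1r].
  apply: eq_bigr => j _; rewrite spin_flip; case: eqP => [->|_]; last by rewrite mul1r.
  by rewrite Td !mul0r.
(* Flipping [v] only changes the sign of the field term [2 * (spin R x v * _)]. Its square is 4
   times that of the sum, whence the 8 after [cosh_le_expR]. *)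
have pair x : expR (energy Theta x) + expR (energy Theta (flip v x)) <=
    2 * (expR (8 * S) * expR (energy Theta' x)).
  rewrite -expRD eT' eT flipE !expRD -mulrDr [leRHS]mulrCA ler_pM2l ?expR_gt0 //.
  apply: le_trans (cosh_le_expR _) _; rewrite ler_pM2l // ler_expR.
  rewrite exprMn exprMn [spin R x v ^+ 2]expr2 spin_sqr; lra.
have IH' : \sum_(x : config d) expR (energy Theta' x) <= 2 ^+ d * expR (8 * norm2 Theta').
  apply: IH => [i j|i|i j si|].
  - by rewrite !mxE eq_sym /p orbC (Tsym j i) (mulrC (Theta v j)).
  - by rewrite mxE eqxx.
  - rewrite mxE /p; case: (eqVneq i v) => [->|iv] /=.
      by rewrite Td mul0r mulr0 addr0 if_same.
    have i_vs : i \notin v :: s by rewrite inE negb_or iv.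
    by rewrite (Tsym v i) !(Ts i) // mul0r mulr0 addr0 !if_same.
  - by apply: le_trans nT' _; lra.
(* Symmetrizing over the flip of [v] stands in for summing out its spin, so [d] is constant while
   the support shrinks. The cost [8 * S] is exactly what [nT'] saves in [8 * norm2 Theta']. *)
rewrite -(@ler_pM2l _ 2) //.
have -> : 2 * (\sum_(x : config d) expR (energy Theta x)) =
    \sum_(x : config d) (expR (energy Theta x) + expR (energy Theta (flip v x))).
  rewrite mulr_natl mulr2n big_split /=; congr (_ + _).
  by rewrite (reindex_inj (can_inj (flipK v))).
apply: le_trans (ler_sum _ (fun x _ => pair x)) _.
rewrite -!mulr_sumr ler_pM2l //.
apply: le_trans (ler_wpM2l (expR_ge0 _) IH') _.
by rewrite mulrCA ler_pM2l ?exprn_gt0 // -expRD ler_expR; lra.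
Qed.

Lemma sum_weight_le (R : realType) (d : nat) (Theta : 'M[R]_d) :
  (forall i j, Theta i j = Theta j i) -> (forall i, Theta i i = 0) ->
  norm2 Theta <= 1 / 400 ->
  \sum_(x : config d) expR (energy Theta x) <= 2 ^+ d * expR (8 * norm2 Theta).
Proof.
move=> Tsym Td; apply: (@sum_weight_le_supp _ _ (enum 'I_d)) => // i j.
by rewrite mem_enum.
Qed.

(** * Griffiths' first inequality and edge correlations *)

(** The sum factorizes over the vertices; a vertex occurring [k] times in [s] contributes
    [1 + (-1)^k], which is 2 or 0. *)
Lemma sum_spin_monomial_ge0 (R : realType) (d : nat) (s : seq 'I_d) :
  0 <= \sum_(x : config d) \prod_(i <- s) spin R x i.
Proof.
have prod_count (f : 'I_d -> R) : \prod_(i <- s) f i = \prod_i f i ^+ count_mem i s.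
  elim: s => [|a s IH]; first by rewrite big_nil big1 // => i _; rewrite expr0.
  rewrite big_cons IH [RHS](eq_bigr (fun i => f i ^+ (a == i) * f i ^+ count_mem i s)).
    rewrite big_split /=; congr (_ * _).
    by rewrite (bigD1 a) //= eqxx big1 ?mulr1 // => i ia; rewrite eq_sym (negPf ia).
  by move=> i _; rewrite /= exprD.
under eq_bigr do rewrite prod_count.
pose F (i : 'I_d) (b : bool) : R := (if b then 1 else -1) ^+ count_mem i s.
rewrite -(bigA_distr_bigA F).
apply: prodr_ge0 => i _; rewrite big_bool /F expr1n -signr_odd.
by case: (odd _); rewrite /= ?expr1 ?expr0 ?subrr ?addr_ge0.
Qed.

(** Expanding one factor at a time either leaves [s] alone or adds two vertices to it, with a
    nonnegative coefficient. The arbitrary list [s], repetitions included, makes this induction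
    close. *)
Lemma sum_spin_affine_ge0 (R : realType) (d : nat) (T : Type) (r : seq T)
    (a b : T -> R) (p : T -> 'I_d * 'I_d) (s : seq 'I_d) :
  (forall t, 0 <= a t) -> (forall t, 0 <= b t) ->
  0 <= \sum_(x : config d) (\prod_(i <- s) spin R x i) *
         \prod_(t <- r) (a t + b t * (spin R x (p t).1 * spin R x (p t).2)).
Proof.
move=> a0 b0; elim: r s => [|t r IH] s.
  by under eq_bigr do rewrite big_nil mulr1; exact: sum_spin_monomial_ge0.
have -> : \sum_(x : config d) (\prod_(i <- s) spin R x i) *
    \prod_(t <- t :: r) (a t + b t * (spin R x (p t).1 * spin R x (p t).2)) =
  a t * (\sum_(x : config d) (\prod_(i <- s) spin R x i) *
    \prod_(t <- r) (a t + b t * (spin R x (p t).1 * spin R x (p t).2))) +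
  b t * (\sum_(x : config d) (\prod_(i <- (p t).1 :: (p t).2 :: s) spin R x i) *
    \prod_(t <- r) (a t + b t * (spin R x (p t).1 * spin R x (p t).2))).
  rewrite !mulr_sumr -big_split; apply: eq_bigr => x _ /=.
  by rewrite !big_cons; ring.
by rewrite addr_ge0 // mulr_ge0.
Qed.

Lemma spin_mulP (R : realType) (d : nat) (x : config d) (i j : 'I_d) :
  spin R x i * spin R x j = 1 \/ spin R x i * spin R x j = -1.
Proof.
rewrite /spin; case: (x i); case: (x j); rewrite ?mulrNN ?mul1r ?mulr1.
- by left.
- by right.
- by right.
- by left.
Qed.

(** Griffiths' first inequality. For [y = 1] or [y = -1], [exp (t y) = cosh t + y sinh t], and both
    coefficients are nonnegative when [t >= 0]. *)
Lemma sum_spin_weight_ge0 (R : realType) (d : nat) (Theta : 'M[R]_d) (s : seq 'I_d) :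
  (forall i j, 0 <= Theta i j) ->
  0 <= \sum_(x : config d) (\prod_(i <- s) spin R x i) * expR (energy Theta x).
Proof.
move=> T0.
pose a (p : 'I_d * 'I_d) := (expR (Theta p.1 p.2) + expR (- Theta p.1 p.2)) / 2.
pose b (p : 'I_d * 'I_d) := (expR (Theta p.1 p.2) - expR (- Theta p.1 p.2)) / 2.
have -> : \sum_(x : config d) (\prod_(i <- s) spin R x i) * expR (energy Theta x) =
    \sum_(x : config d) (\prod_(i <- s) spin R x i) *
      \prod_p (a p + b p * (spin R x p.1 * spin R x p.2)).
  apply: eq_bigr => x _; congr (_ * _).
  rewrite /energy pair_big expR_sum; apply: eq_bigr => p _ /=.
  rewrite -mulrA /a /b; case: (spin_mulP R x p.1 p.2) => ->; rewrite ?mulr1 ?mulrN1; lra.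
apply: sum_spin_affine_ge0 => p; rewrite ?/a ?/b divr_ge0 //.
by rewrite subr_ge0 ler_expR; have := T0 p.1 p.2; lra.
Qed.

Lemma energyD (R : realType) (d : nat) (A B : 'M[R]_d) (x : config d) :
  energy (A + B) x = energy A x + energy B x.
Proof.
rewrite /energy -big_split; apply: eq_bigr => i _ /=.
by rewrite -big_split; apply: eq_bigr => j _ /=; rewrite mxE; ring.
Qed.

Lemma energyZ (R : realType) (d : nat) (c : R) (A : 'M[R]_d) (x : config d) :
  energy (c *: A) x = c * energy A x.
Proof.
rewrite /energy mulr_sumr; apply: eq_bigr => i _ /=.
by rewrite mulr_sumr; apply: eq_bigr => j _ /=; rewrite mxE; ring.
Qed.

Lemma energy_delta (R : realType) (d : nat) (i j : 'I_d) (x : config d) :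
  energy (delta_mx i j) x = spin R x i * spin R x j.
Proof.
rewrite /energy (bigD1 i) //= (bigD1 j) //= mxE !eqxx mul1r.
rewrite big1 => [|k /negPf kj]; last by rewrite mxE kj andbF !mul0r.
rewrite big1 => [|k /negPf ki]; first by rewrite !addr0.
by rewrite big1 // => l _; rewrite mxE ki !mul0r.
Qed.

(** Moving [theta / 2] out of both entries of the edge leaves a ferromagnetic matrix and the factor
    [exp (theta y)], with [y] the product of the two spins. Then
    [(y - theta / 2) exp (theta y) = a y + b], and Griffiths' inequality applies; [b >= 0] amounts
    to [tanh theta >= theta / 2]. *)
Lemma corr_ge (R : realType) (d : nat) (Theta : 'M[R]_d) (theta : R) (i j : 'I_d) :
  0 <= theta <= 1 -> i != j -> (forall k l, 0 <= Theta k l) ->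
  theta / 2 <= Theta i j -> theta / 2 <= Theta j i ->
  0 <= \sum_(x : config d)
         (spin R x i * spin R x j - theta / 2) * expR (energy Theta x).
Proof.
move=> /andP[t0 t1] ij T0 Tij Tji.
pose D : 'M[R]_d := (theta / 2) *: (delta_mx i j + delta_mx j i).
have Te x : energy Theta x = energy (Theta - D) x + theta * (spin R x i * spin R x j).
  have -> : energy Theta x = energy (Theta - D) x + energy D x.
    by rewrite -energyD subrK.
  by congr (_ + _); rewrite energyZ energyD !energy_delta; field.
have TD k l : 0 <= (Theta - D) k l.
  rewrite !mxE; case: (boolP ((k == i) && (l == j))) => [/andP[/eqP -> /eqP ->]|_].
    by rewrite (negPf ij) addr0 mulr1 subr_ge0.
  case: (boolP ((k == j) && (l == i))) => [/andP[/eqP -> /eqP ->]|_].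
    by rewrite add0r mulr1 subr_ge0.
  by rewrite addr0 mulr0 subr0.
pose a := ((1 - theta / 2) * expR theta + (1 + theta / 2) * expR (- theta)) / 2.
pose b := ((1 - theta / 2) * expR theta - (1 + theta / 2) * expR (- theta)) / 2.
have -> : \sum_(x : config d) (spin R x i * spin R x j - theta / 2) * expR (energy Theta x) =
    a * (\sum_(x : config d) (\prod_(k <- [:: i; j]) spin R x k) * expR (energy (Theta - D) x)) +
    b * (\sum_(x : config d) (\prod_(k <- [::]) spin R x k) * expR (energy (Theta - D) x)).
  rewrite !mulr_sumr -big_split; apply: eq_bigr => x _ /=.
  rewrite Te expRD !big_cons !big_nil mulr1 /a /b.
  by case: (spin_mulP R x i j) => ->; rewrite ?mulr1 ?mulrN1; field.
have e1 : 0 < expR (- theta) by exact: expR_gt0.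
have e2 : expR theta * expR (- theta) = 1 by rewrite -expRD subrr expR0.
have e3 : 1 + theta <= expR theta by exact: expR_ge1Dx.
have e4 : expR (- theta) * (1 + theta) <= 1.
  by have := ler_wpM2r (ltW e1) e3; rewrite e2 mulrC.
have e5 : expR (- theta) <= 1 by rewrite -expR0 ler_expR oppr_le0.
rewrite addr_ge0 // mulr_ge0 ?sum_spin_weight_ge0 // /a /b divr_ge0 //; nra.
Qed.

(** * Edge sums as energies, and the effect of lowering couplings *)

Definition edge_sum (R : realType) (d : nat) (H : sgraph d) (x : config d) : R :=
  \sum_(e in edges H) \prod_(i in e) spin R x i.

Definition adjacency (R : realType) (d : nat) (H : sgraph d) : 'M[R]_d :=
  \matrix_(i, j) ([set i; j]%SET \in edges H)%:R.

Lemma edge_card (d : nat) (H : sgraph d) (e : {set 'I_d}) :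
  e \in edges H -> #|e| == 2%N.
Proof. by case: H => E /= /forall_inP; apply. Qed.

Lemma edge_neq (d : nat) (H : sgraph d) (i j : 'I_d) :
  [set i; j]%SET \in edges H -> i != j.
Proof. by move=> /edge_card; rewrite cards2; case: (i == j). Qed.

Lemma set2_eq (T : finType) (a b i j : T) :
  ([set i; j]%SET == [set a; b]%SET) = ((i, j) == (a, b)) || ((i, j) == (b, a)).
Proof.
apply/eqP/orP => [E|[] /eqP[-> ->] //]; last by rewrite finset.setUC.
have hi : i \in [set a; b]%SET by rewrite -E finset.set21.
have hj : j \in [set a; b]%SET by rewrite -E finset.set22.
have ha : a \in [set i; j]%SET by rewrite E finset.set21.
have hb : b \in [set i; j]%SET by rewrite E finset.set22.
case/finset.set2P: hi => hi; case/finset.set2P: hj => hj; rewrite hi hj in ha hb *.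
- by case/finset.set2P: hb => ->; left.
- by left.
- by right.
- by case/finset.set2P: ha => ->; left.
Qed.

(** An edge is the image of exactly two ordered pairs; diagonal pairs give singletons, which are
    never edges. *)
Lemma sum_over_edges (R : realType) (d : nat) (H : sgraph d) (f : {set 'I_d} -> R) :
  \sum_i \sum_j (if [set i; j]%SET \in edges H then f [set i; j]%SET else 0) =
  2 * \sum_(e in edges H) f e.
Proof.
rewrite pair_big -big_mkcond /=.
rewrite (partition_big (fun p : 'I_d * 'I_d => [set p.1; p.2]%SET)
          (mem (edges H))) //= mulr_sumr; apply: eq_bigr => e eH.
have /cards2P[a [b [ab eab]]] := edge_card eH.
transitivity (\sum_(p in [set (a, b); (b, a)]%SET) f e).
  apply: eq_big => p; last by case/andP => _ /eqP ->.
  rewrite finset.in_set2; case: p => i j; rewrite -set2_eq -eab /=.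
  by case: eqP => [->|]; rewrite ?eH ?andbF.
by rewrite sumr_const cards2 xpair_eqE negb_and ab mulr_natl.
Qed.

Lemma edge_prod (R : realType) (d : nat) (x : config d) (i j : 'I_d) :
  i != j -> \prod_(k in [set i; j]%SET) spin R x k = spin R x i * spin R x j.
Proof. by move=> ij; rewrite finset.big_setU1 ?finset.big_set1 // finset.in_set1. Qed.

Lemma energy_adjacency (R : realType) (d : nat) (H : sgraph d) (x : config d) :
  energy (adjacency R H) x = 2 * edge_sum R H x.
Proof.
rewrite -sum_over_edges; apply: eq_bigr => i _; apply: eq_bigr => j _.
rewrite mxE; case: ifP => [/edge_neq ij|_]; last by rewrite !mul0r.
by rewrite edge_prod // mul1r.
Qed.

Lemma norm2_adjacency (R : realType) (d : nat) (H : sgraph d) :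
  norm2 (adjacency R H) = 2 * #|edges H|%:R.
Proof.
rewrite -sumr_const -sum_over_edges; apply: eq_bigr => i _; apply: eq_bigr => j _.
by rewrite mxE; case: ifP; rewrite ?expr1n ?expr0n.
Qed.

Lemma norm2Z (R : realType) (d : nat) (c : R) (A : 'M[R]_d) :
  norm2 (c *: A) = c ^+ 2 * norm2 A.
Proof.
rewrite /norm2 mulr_sumr; apply: eq_bigr => i _.
by rewrite mulr_sumr; apply: eq_bigr => j _; rewrite mxE exprMn.
Qed.

(* By Jensen, the ratio of the partition functions of [Theta] and of
   [Theta' := Theta - (theta / 2) *: adjacency R H] is at least
   exp (theta E_Theta' (edge_sum)), and Theta' is still ferromagnetic. *)
Lemma sum_tilted_weight_le (R : realType) (d : nat) (H : sgraph d)
    (Theta : 'M[R]_d) (theta : R) :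
  0 <= theta <= 1 -> (forall i j, 0 <= Theta i j) ->
  (forall i j, [set i; j]%SET \in edges H -> theta <= Theta i j) ->
  \sum_(x : config d) expR (energy Theta x - theta * edge_sum R H x) <=
    expR (- (theta ^+ 2 / 2 * #|edges H|%:R)) * \sum_(x : config d) expR (energy Theta x).
Proof.
move=> t01 T0 TH; have /andP[t0 t1] := t01.
pose Theta' := Theta - (theta / 2) *: adjacency R H.
have Te x : energy Theta x - theta * edge_sum R H x = energy Theta' x.
  by rewrite /Theta' -[in RHS]scaleNr energyD energyZ energy_adjacency; field.
under eq_bigr do rewrite Te.
rewrite expRN mulrC ler_pdivlMr ?expR_gt0 // mulr_suml.
have T0' i j : 0 <= Theta' i j.
  rewrite !mxE; case: (boolP (_ \in _)) => [/TH|_] /=; first by lra.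
  by rewrite mulr0 subr0.
have Te' i j : [set i; j]%SET \in edges H -> theta / 2 <= Theta' i j.
  by move=> ijH; rewrite !mxE ijH mulr1; have := TH _ _ ijH; lra.
set m := theta ^+ 2 / 2 * _.
have corr : 0 <= \sum_(x : config d)
    (edge_sum R H x - #|edges H|%:R * (theta / 2)) * expR (energy Theta' x).
  have -> : \sum_(x : config d)
      (edge_sum R H x - #|edges H|%:R * (theta / 2)) * expR (energy Theta' x) =
    \sum_(e in edges H) \sum_(x : config d)
      (\prod_(i in e) spin R x i - theta / 2) * expR (energy Theta' x).
    rewrite exchange_big; apply: eq_bigr => x _ /=.
    by rewrite -mulr_suml sumrB sumr_const mulr_natl.
  apply: sumr_ge0 => e eH; have /cards2P[i [j [ij eij]]] := edge_card eH.
  subst e; under eq_bigr do rewrite edge_prod //.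
  by apply: corr_ge => //; apply: Te'; rewrite // finset.setUC.
(* Jensen's inequality in tangent form: [1 + y <= expR y] for each configuration, with [y] equal to
   [theta] times the deviation of the edge sum from its lower bound. The linear terms add up to a
   multiple of [corr]. *)
rewrite -subr_ge0.
have : 0 <= expR m * (theta * \sum_(x : config d)
    (edge_sum R H x - #|edges H|%:R * (theta / 2)) * expR (energy Theta' x)).
  by rewrite !mulr_ge0 // expR_ge0.
move=> /le_trans; apply; rewrite -sumrB !mulr_sumr; apply: ler_sum => x _.
have -> : energy Theta x = energy Theta' x + m +
   theta * (edge_sum R H x - #|edges H|%:R * (theta / 2)).
  by rewrite -Te /m; field.
rewrite !expRD; set y := theta * (_ - _).
have hy : 1 + y <= expR y by exact: expR_ge1Dx.
have w0 : 0 <= expR (energy Theta' x) * expR m by rewrite mulr_ge0 ?expR_ge0.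
have := ler_wpM2l w0 hy; rewrite [theta * (_ * _)]mulrA -/y; lra.
Qed.

(** * Chernoff bounds for the edge statistic *)

Lemma partition_gt0 (R : realType) (d : nat) (Theta : 'M[R]_d) :
  0 < partition_function Theta.
Proof.
rewrite /partition_function (bigD1 [ffun=> true]) //=.
by rewrite ltr_pwDl ?expR_gt0 // sumr_ge0 // => x _; exact: expR_ge0.
Qed.

Lemma sum_ising_expR (R : realType) (d : nat) (Theta : 'M[R]_d) (f : config d -> R) :
  \sum_(x : config d) ising Theta x * expR (f x) =
  (\sum_(x : config d) expR (energy Theta x + f x)) / partition_function Theta.
Proof.
by rewrite mulr_suml; apply: eq_bigr => x _; rewrite expRD mulrAC.
Qed.

Lemma ising_ge0 (R : realType) (d : nat) (Theta : 'M[R]_d) (x : config d) :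
  0 <= ising Theta x.
Proof. by rewrite divr_ge0 ?expR_ge0 // ltW // partition_gt0. Qed.

(** Chernoff's method: the indicator of [A] is at most the exponential of the sum minus [c], whose
    expectation factorizes by independence. *)
Lemma prob_le_expR (R : realType) (d n : nat) (Theta : 'M[R]_d)
    (A : pred (samples d n)) (f : config d -> R) (c : R) :
  (forall X, A X -> c <= \sum_(l < n) f (X l)) ->
  prob Theta A <= expR (- c) * (\sum_(x : config d) ising Theta x * expR (f x)) ^+ n.
Proof.
move=> Af.
have -> : (\sum_(x : config d) ising Theta x * expR (f x)) ^+ n =
    \sum_(X : samples d n) (\prod_(l < n) ising Theta (X l)) * expR (\sum_(l < n) f (X l)).
  rewrite -[in LHS](card_ord n) -prodr_const.
  rewrite (bigA_distr_bigA (fun (_ : 'I_n) x => ising Theta x * expR (f x))).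
  by apply: eq_bigr => X _; rewrite big_split expR_sum.
rewrite mulr_sumr /prob big_mkcond; apply: ler_sum => X _.
have P0 : 0 <= \prod_(l < n) ising Theta (X l) by apply: prodr_ge0 => l _; exact: ising_ge0.
case: ifP => [/Af h|_]; last by rewrite !mulr_ge0 ?expR_ge0.
rewrite mulrCA -expRD ler_peMr // -expR0 ler_expR; lra.
Qed.

Lemma W_stat_edge_sum (R : realType) (d n : nat) (H : sgraph d) (X : samples d n) :
  (0 < n)%N -> (0 < #|edges H|)%N ->
  \sum_(l < n) edge_sum R H (X l) = n%:R * #|edges H|%:R * W_stat R H X.
Proof.
rewrite !lt0n -!(pnatr_eq0 R) => n0 E0.
by rewrite /W_stat -mulr_sumr mulrACA divff // mul1r mulrA divff // mul1r.
Qed.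

(** The tilt [u * edge_sum] is the energy of [(u / 2) *: adjacency R H], with squared norm
    [u ^+ 2 * #|edges H| / 2]; so the bound 1/200 is the 1/400 of [sum_weight_le]. *)
Lemma prob0_W_stat_gt (R : realType) (d n : nat) (H : sgraph d) (u t : R) :
  (0 < n)%N -> (0 < #|edges H|)%N -> 0 <= u ->
  u ^+ 2 * #|edges H|%:R <= 1 / 200 ->
  prob (0 : 'M[R]_d) (fun X : samples d n => t < W_stat R H X) <=
    expR (n%:R * (4 * (u ^+ 2 * #|edges H|%:R)) - u * n%:R * #|edges H|%:R * t).
Proof.
move=> n0 E0 u0 hu.
have energy0 x : energy (0 : 'M[R]_d) x = 0.
  by rewrite /energy big1 // => i _; rewrite big1 // => j _; rewrite mxE !mul0r.
apply: le_trans (@prob_le_expR _ _ _ _ _ (fun x => u * edge_sum R H x)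
    (u * n%:R * #|edges H|%:R * t) _) _.
  move=> X /ltW tW; rewrite -mulr_sumr W_stat_edge_sum // -!mulrA !ler_wpM2l //.
rewrite addrC expRD ler_pM2l ?expR_gt0 // expRM_natl; apply: lerXn2r.
- by rewrite nnegrE sumr_ge0 // => x _; rewrite mulr_ge0 ?ising_ge0 ?expR_ge0.
- by rewrite nnegrE expR_ge0.
rewrite sum_ising_expR ler_pdivrMr ?partition_gt0 //.
have -> : partition_function (0 : 'M[R]_d) = 2 ^+ d.
  rewrite /partition_function (eq_bigr (fun=> 1)) => [|x _].
    by rewrite sumr_const card_ffun card_bool card_ord natrX.
  by rewrite -expR0; congr expR; exact: energy0.
pose Theta := (u / 2) *: adjacency R H.
have nT : norm2 Theta = u ^+ 2 * #|edges H|%:R / 2.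
  by rewrite norm2Z norm2_adjacency; field.
have -> : 4 * (u ^+ 2 * #|edges H|%:R) = 8 * norm2 Theta by rewrite nT; field.
rewrite mulrC (eq_bigr (fun x => expR (energy Theta x))) => [|x _]; last first.
  by rewrite energy0 add0r energyZ energy_adjacency; congr expR; field.
apply: sum_weight_le => [i j|i|].
- by rewrite !mxE finset.setUC.
- by rewrite !mxE; case: (boolP (_ \in _)) => [/edge_neq|]; rewrite ?eqxx ?mulr0.
by rewrite nT; lra.
Qed.

(** Chernoff's method with tilt [- theta], which takes away at most half of each coupling on [H], so
    that the tilted model stays ferromagnetic. *)
Lemma prob_W_stat_le (R : realType) (d n : nat) (H : sgraph d) (Theta : 'M[R]_d)
    (theta t : R) :
  (0 < n)%N -> (0 < #|edges H|)%N -> 0 <= theta <= 1 ->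
  (forall i j, 0 <= Theta i j) ->
  (forall i j, [set i; j]%SET \in edges H -> theta <= Theta i j) ->
  prob Theta (fun X : samples d n => W_stat R H X <= t) <=
    expR (- (n%:R * theta * #|edges H|%:R * (theta / 2 - t))).
Proof.
move=> n0 E0 t01 T0 TH; have /andP[t0 t1] := t01.
apply: le_trans (@prob_le_expR _ _ _ _ _ (fun x => - (theta * edge_sum R H x))
    (- (theta * n%:R * #|edges H|%:R * t)) _) _.
  move=> X Wt; rewrite sumrN -mulr_sumr W_stat_edge_sum // lerN2 -!mulrA.
  by rewrite !ler_wpM2l.
have -> : - (n%:R * theta * #|edges H|%:R * (theta / 2 - t)) =
    - - (theta * n%:R * #|edges H|%:R * t) + n%:R * - (theta ^+ 2 / 2 * #|edges H|%:R).
  by field.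
rewrite expRD ler_pM2l ?expR_gt0 // expRM_natl; apply: lerXn2r.
- by rewrite nnegrE sumr_ge0 // => x _; rewrite mulr_ge0 ?ising_ge0 ?expR_ge0.
- by rewrite nnegrE expR_ge0.
rewrite sum_ising_expR ler_pdivrMr ?partition_gt0 //.
exact: sum_tilted_weight_le.
Qed.

(** * Minima, arboricity and edge counts *)

Lemma min_over_le (T : finType) (A : {set T}) (f : T -> nat) (x : T) :
  x \in A -> (min_over A f <= f x)%N.
Proof.
rewrite /min_over; set z := (\max_(y in A) f y)%N; move: z => z xA.
have : x \in index_enum T by exact: mem_index_enum.
elim: (index_enum T) => // y r IH; rewrite inE big_cons => /orP[/eqP <-|/IH h].
  by rewrite xA geq_minl.
by case: ifP => // _; rewrite geq_min h orbT.
Qed.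

Lemma min_over_gt0 (T : finType) (A : {set T}) (f : T -> nat) (x : T) :
  x \in A -> (forall y, y \in A -> (0 < f y)%N) -> (0 < min_over A f)%N.
Proof.
move=> xA f0; rewrite /min_over.
(* The default value of the minimum has to be positive as well. *)
have : (0 < \max_(y in A) f y)%N.
  exact: leq_trans (f0 x xA) (@leq_bigmax_cond _ (mem A) f x xA).
move: (\max_(y in A) f y)%N => z z0.
apply: (@big_ind _ (fun k => 0 < k)%N) => // a b a0 b0.
by rewrite leq_min a0.
Qed.

Lemma arboricity_gt0 (d : nat) (G : sgraph d) :
  edges G != finset.set0 -> (0 < arboricity G)%N.
Proof.
case/finset.set0Pn => e eG; rewrite /arboricity absz_gt0 ceil_neq0; apply/orP; right.
(* An edge taken as vertex set already has positive density. *)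
apply: lt_le_trans (le_bigmax _ (fun V => density #|edges_in G V| #|V|) e) => /=.
have /eqP -> := edge_card eG.
rewrite /density divr_gt0 // ltr0n card_gt0.
by apply/finset.set0Pn; exists e; rewrite inE eG subxx.
Qed.

(** With [V] vertices and [E] edges, the ceiling gives [(r - 1) (V - 1) < E]. Since [2 <= V <= 2 E],
    the product [r V = (r - 1) (V - 1) + (r - 1) + V] is at most [E + E + 2 E]. *)
Lemma ceil_density_edges (d : nat) (H : sgraph d) (r : nat) :
  (0 < r)%N -> (r <= ceil_density H)%N ->
  [/\ (0 < #|edges H|)%N, (0 < #|vertices H|)%N & (r * #|vertices H| <= 4 * #|edges H|)%N].
Proof.
move=> r0; rewrite /ceil_density /density.
have [->|E0] := posnP #|edges H|.
  by rewrite mul0r ceil0 leqNgt r0.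
have V2E : (#|vertices H| <= 2 * #|edges H|)%N.
  apply: leq_trans (finset.leq_card_cover _) _.
  rewrite (eq_bigr (fun=> 2%N)) => [|e /edge_card/eqP //].
  by rewrite sum_nat_const mulnC.
have V2 : (2 <= #|vertices H|)%N.
  have [e eH] : exists e, e \in edges H by apply/finset.set0Pn; rewrite -card_gt0.
  rewrite -(eqP (edge_card eH)); apply/subset_leq_card/finset.bigcup_sup; exact: eH.
move: V2 V2E E0; set V := #|vertices H|; set E := #|edges H| => V2 V2E E0 hr.
split=> //; first by lia.
have rE : (r.-1 * V.-1 < E)%N.
  have d0 : 0 <= E%:R / (V%:R - 1) :> rat.
    by rewrite divr_ge0 ?ler0n // subr_ge0 ler1n; lia.
  have : (r.-1%:Z < Num.ceil (E%:R / (V%:R - 1) : rat)).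
    have : 0 <= Num.ceil (E%:R / (V%:R - 1) : rat) by rewrite ceil_ge0; lra.
    by move: (Num.ceil _) hr => c; lia.
  have -> : V%:R - 1 = V.-1%:R :> rat by rewrite -subn1 natrB //; lia.
  rewrite ceil_gt_int ltr_pdivlMr ?ltr0n; last by lia.
  by rewrite -natrM ltr_nat.
nia.
Qed.

(** * Union bound and the two error probabilities *)

Lemma prob_le_sum (R : realType) (d n : nat) (Theta : 'M[R]_d) (I : finType)
    (A : {set I}) (P : I -> pred (samples d n)) (Q : pred (samples d n)) :
  (forall X, Q X -> exists2 i, i \in A & P i X) ->
  prob Theta Q <= \sum_(i in A) prob Theta (P i).
Proof.
move=> QP.
have p0 (X : samples d n) : 0 <= \prod_(l < n) ising Theta (X l) by apply: prodr_ge0 => l _; exact: ising_ge0.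
rewrite /prob; under [leRHS]eq_bigr do rewrite big_mkcond.
rewrite exchange_big big_mkcond; apply: ler_sum => X _ /=.
case: ifP => [/QP[i iA Pi]|_]; last first.
  by apply: sumr_ge0 => i _; case: ifP.
rewrite (bigD1 i) //= Pi lerDl; apply: sumr_ge0 => j _.
by case: ifP.
Qed.

Lemma le_prob (R : realType) (d n : nat) (Theta : 'M[R]_d) (P Q : pred (samples d n)) :
  (forall X, P X -> Q X) -> prob Theta P <= prob Theta Q.
Proof.
move=> PQ; apply: le_trans (@prob_le_sum _ _ _ Theta unit [set tt] (fun=> Q) P _) _.
  by move=> X /PQ QX; exists tt; rewrite // inE.
by rewrite finset.big_set1.
Qed.

Lemma signal_level_sqr (R : realType) (d n : nat) (G1 HH : {set sgraph d}) :
  (0 < #|HH|)%N ->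
  signal_level R n G1 HH ^+ 2 =
    ln #|HH|%:R / ((min_vertices HH)%:R * ((min_arboricity G1)%:R * n%:R)).
Proof.
move=> N0; rewrite /signal_level sqr_sqrtr /witness_entropy ?invfM ?mulrA //.
by rewrite !mulr_ge0 ?invr_ge0 ?ler0n // ln_ge0 // ler1n.
Qed.

(** This compares the common threshold with each [H]: the squared signal level is at least
    [ln #|HH| / (4 n #|edges H|)]. *)
Lemma min_vertices_edges (d r : nat) (HH : {set sgraph d}) (H : sgraph d) :
  (0 < r)%N -> (forall H', H' \in HH -> (r <= ceil_density H')%N) -> H \in HH ->
  [/\ (0 < #|edges H|)%N, (0 < min_vertices HH)%N &
      (min_vertices HH * r <= 4 * #|edges H|)%N].
Proof.
move=> r0 HHr HHH; have [E0 V0 VE] := ceil_density_edges r0 (HHr _ HHH).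
split=> //; last by rewrite mulnC (leq_trans _ VE) // leq_mul2l min_over_le ?orbT.
by apply: (min_over_gt0 HHH) => H' /HHr hH'; have [] := ceil_density_edges r0 hH'.
Qed.

Lemma type1_error_le (R : realType) (d n : nat) (kappa : R) (G1 HH : {set sgraph d}) :
  48 <= kappa -> (0 < n)%N -> (1 < #|HH|)%N -> (0 < min_arboricity G1)%N ->
  (forall H, H \in HH -> (min_arboricity G1 <= ceil_density H)%N) ->
  ln (#|HH|%:R : R) / n%:R <= 1 / 200 ->
  prob (0 : 'M[R]_d) (@witness_test R d n kappa G1 HH) <= #|HH|%:R^-1.
Proof.
move=> kappa48 n0 N1 r0 HHr Ln.
set L : R := ln _ in Ln *; set r := min_arboricity G1 in r0 HHr *.
have N0 : (0 < #|HH|)%N by exact: ltnW.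
have L0 : 0 < L by rewrite ln_gt0 // ltr1n.
have eL : expR L = #|HH|%:R by rewrite lnK // posrE ltr0n.
pose s := signal_level R n G1 HH.
have s0 : 0 <= s by exact: sqrtr_ge0.
have nR0 : 0 < n%:R :> R by rewrite ltr0n.
apply: le_trans (@prob_le_sum _ _ _ _ _ HH
    (fun H X => kappa / 4 * s < W_stat R H X) _ _) _.
  move=> X; rewrite /witness_test -/s; case: (boolP [exists H in HH, kappa / 4 * s < W_stat R H X]).
    by move=> /exists_inP[H HHH HW] _; exists H.
  rewrite negb_exists_in => /forall_inP hW; rewrite ltNge => /negP[].
  apply/bigmax_leP; split=> [|H /hW]; last by rewrite -leNgt.
  (* The default value [-1] of the maximum lies below the nonnegative threshold. *)
  by apply: (@le_trans _ _ 0); rewrite ?lerN10 // mulr_ge0 // divr_ge0 //; lra.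
(* Each [H] may thus contribute [expR (- (2 * L))], the inverse square of [#|HH|]. *)
have NN : #|HH|%:R^-1 = \sum_(H in HH) expR (- (2 * L)).
  rewrite sumr_const -[RHS]mulr_natl -eL expRN expRM_natl.
  by field; rewrite gt_eqF // expR_gt0.
rewrite NN; apply: ler_sum => H HHH.
have [E0 m0 mrE] := min_vertices_edges r0 HHr HHH.
set E := #|edges H| in E0 mrE; set m := min_vertices HH in m0 mrE.
have ER0 : 0 < E%:R :> R by rewrite ltr0n.
have mr0 : 0 < m%:R * r%:R :> R by rewrite mulr_gt0 ?ltr0n.
have mrER : m%:R * r%:R <= 4 * E%:R :> R by rewrite -!natrM ler_nat.
pose u := Num.sqrt (L / (n%:R * E%:R)).
have u0 : 0 <= u by exact: sqrtr_ge0.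
have u2 : u ^+ 2 = L / (n%:R * E%:R).
  by rewrite sqr_sqrtr // divr_ge0 ?ltW // mulr_gt0.
have u2E : u ^+ 2 * E%:R = L / n%:R.
  by rewrite u2; field; rewrite ?gt_eqF.
apply: le_trans (prob0_W_stat_gt _ n0 E0 u0 _) _; rewrite -/E u2E //.
have us : L / (2 * (n%:R * E%:R)) <= u * s.
  have q0 : 0 <= L / (2 * (n%:R * E%:R)) by rewrite divr_ge0 ?ltW // !mulr_gt0.
  rewrite -(@ler_pXn2r _ 2%N) // ?nnegrE ?q0 ?(mulr_ge0 u0 s0) //.
  rewrite [leRHS]exprMn u2 signal_level_sqr // -/L -/r -/m.
  have -> : L / (n%:R * E%:R) * (L / (m%:R * (r%:R * n%:R))) =
    (L / n%:R) ^+ 2 / E%:R / (m%:R * r%:R).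
    by field; rewrite !pnatr_eq0 -!lt0n n0 E0 m0 r0.
  have -> : (L / (2 * (n%:R * E%:R))) ^+ 2 = (L / n%:R) ^+ 2 / E%:R / (4 * E%:R).
    by field; rewrite !pnatr_eq0 -!lt0n n0 E0.
  rewrite ler_wpM2l //; last by rewrite lef_pV2 // posrE // mulr_gt0.
  by rewrite divr_ge0 ?sqr_ge0 // ltW.
have us' : L / 2 <= u * n%:R * E%:R * s.
  have -> : L / 2 = n%:R * E%:R * (L / (2 * (n%:R * E%:R))).
    by field; rewrite !pnatr_eq0 -!lt0n n0 E0.
  have -> : u * n%:R * E%:R * s = n%:R * E%:R * (u * s) by ring.
  by rewrite ler_wpM2l // mulr_ge0.
(* The exponent is at most [4 L - (kappa / 4) (L / 2)]; [kappa >= 48] makes this at most [- 2 L]. *)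
rewrite ler_expR.
have -> : n%:R * (4 * (L / n%:R)) = 4 * L by field; rewrite gt_eqF.
have -> : u * n%:R * E%:R * (kappa / 4 * s) = kappa / 4 * (u * n%:R * E%:R * s) by ring.
move: (u * _ * _ * s) us' => q q0; nra.
Qed.

Lemma support_edgeP (R : realType) (d : nat) (Theta : 'M[R]_d) (i j : 'I_d) :
  (forall i, Theta i i = 0) -> Theta i j != 0 ->
  [set i; j]%SET \in edges (support_graph Theta).
Proof.
move=> T0 Tij; apply/imsetP; exists (i, j) => //=; rewrite inE /= Tij andbT.
by apply: contraNneq Tij => ->; rewrite T0.
Qed.

(** A single witness [H] of the support graph suffices. The threshold uses up at most [theta / 4] of
    the mean bound [theta / 2], which leaves the exponent [n E theta^2 / 4 >= 4 n E s^2 >= L]. *)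
Lemma type2_error_le (R : realType) (d n : nat) (kappa theta : R)
    (G1 HH : {set sgraph d}) (Theta : 'M[R]_d) :
  4 <= kappa -> (0 < n)%N -> (1 < #|HH|)%N -> (0 < min_arboricity G1)%N ->
  witnessing_set G1 HH ->
  (forall H, H \in HH -> (min_arboricity G1 <= ceil_density H)%N) ->
  0 < theta -> kappa * signal_level R n G1 HH < theta ->
  ising_class G1 theta Theta ->
  prob Theta (fun X : samples d n => ~~ witness_test kappa G1 HH X) <= #|HH|%:R^-1.
Proof.
move=> kappa4 n0 N1 r0 wit HHr theta0 theta_s [Tsym Td TG1 Tfrob Ttheta].
have [H HHH [/fintype.subsetP HG _]] := wit _ TG1.
have [E0 m0 mrE] := min_vertices_edges r0 HHr HHH.
have TH i j : [set i; j]%SET \in edges H -> theta <= Theta i j.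
  by move=> /HG; exact: Ttheta.
have T0 i j : 0 <= Theta i j.
  have [->//|Tij] := eqVneq (Theta i j) 0.
  by apply: le_trans (ltW theta0) (Ttheta _ _ (support_edgeP Td Tij)).
(* An entry on an edge of [H] is at least [theta], and the Frobenius norm bounds it by 1/2. *)
have theta1 : theta <= 1.
  have [e eH] : exists e, e \in edges H by apply/finset.set0Pn; rewrite -card_gt0.
  have /cards2P[i [j [_ eij]]] := edge_card eH; rewrite eij in eH.
  apply: le_trans (TH _ _ eH) _.
  have : Num.sqrt (Theta i j ^+ 2) <= 1 / 2.
    apply: le_trans Tfrob; apply: ler_wsqrtr.
    rewrite (bigD1 i) //= (bigD1 j) //= -addrA lerDl addr_ge0 // sumr_ge0 // => k _.
      exact: sqr_ge0.
    by rewrite sumr_ge0 // => l _; exact: sqr_ge0.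
  by rewrite sqrtr_sqr => h; have := ler_norm (Theta i j); lra.
set r := min_arboricity G1 in r0 HHr mrE *; set m := min_vertices HH in m0 mrE.
set E := #|edges H| in E0 mrE; pose s := signal_level R n G1 HH.
pose L : R := ln #|HH|%:R.
have L0 : 0 < L by rewrite ln_gt0 // ltr1n.
have eL : expR L = #|HH|%:R by rewrite lnK // posrE ltr0n (ltnW N1).
have s0 : 0 <= s by exact: sqrtr_ge0.
have ER0 : 0 < E%:R :> R by rewrite ltr0n.
have nR0 : 0 < n%:R :> R by rewrite ltr0n.
have mr0 : 0 < m%:R * r%:R :> R by rewrite mulr_gt0 ?ltr0n.
have mrER : m%:R * r%:R <= 4 * E%:R :> R by rewrite -!natrM ler_nat.
apply: le_trans (le_prob (Q := fun X => W_stat R H X <= kappa / 4 * s) _ _) _.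
  move=> X; rewrite /witness_test -/s -leNgt => /bigmax_leP[_]; exact.
apply: le_trans (prob_W_stat_le _ n0 E0 _ T0 TH) _; first by rewrite (ltW theta0).
rewrite -eL -expRN ler_expR lerN2 -/E.
have t_le : theta / 4 <= theta / 2 - kappa / 4 * s.
  have -> : kappa / 4 * s = kappa * s / 4 by field.
  by move: theta_s; rewrite -/s; lra.
apply: (@le_trans _ _ (n%:R * E%:R * theta ^+ 2 / 4)); last first.
  have -> : n%:R * E%:R * theta ^+ 2 / 4 = n%:R * theta * E%:R * (theta / 4) by field.
  by rewrite ler_wpM2l // !mulr_ge0 // ltW.
have s2 : 16 * s ^+ 2 <= theta ^+ 2.
  have -> : 16 * s ^+ 2 = (4 * s) ^+ 2 by ring.
  rewrite ler_pXn2r // ?nnegrE ?mulr_ge0 ?(ltW theta0) //.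
  by apply: le_trans (ltW theta_s); rewrite ler_wpM2r.
have Ls : L <= 4 * (n%:R * E%:R * s ^+ 2).
  rewrite (signal_level_sqr _ _ _ (ltnW N1)) -/L -/m -/r.
  have -> : 4 * (n%:R * E%:R * (L / (m%:R * (r%:R * n%:R)))) =
      L * (4 * E%:R) / (m%:R * r%:R).
    by field; rewrite !pnatr_eq0 -!lt0n n0 m0 r0.
  by rewrite ler_pdivlMr // ler_wpM2l // ltW.
have nE0 : 0 <= n%:R * E%:R :> R by rewrite mulr_ge0.
have := ler_wpM2l nE0 s2; rewrite mulrCA; lra.
Qed.

(** * Risk bound for large sample sizes *)

Local Open Scope classical_set_scope.

Theorem theorem3p3 (R : realType) :
  exists2 kappa0 : R, 0 < kappa0 &
  forall (kappa : R), kappa0 <= kappa ->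
  forall (alpha : R), 0 < alpha < 1 ->
  forall (d : nat -> nat)
         (G1 HH : forall n : nat, {set sgraph (d n)})
         (theta : nat -> R),
  (forall n, G1 n != finset.set0) ->
  (forall n, empty_graph (d n) \notin G1 n) ->
  (forall n, witnessing_set (G1 n) (HH n)) ->
  (* the members of HH n meet the density bound of witnessing subgraphs *)
  (forall n H, H \in HH n -> (min_arboricity (G1 n) <= ceil_density H)%N) ->
  (fun n => ln (#|HH n|%:R : R) / n%:R) @ \oo --> (0 : R) ->
  (forall n, 2 / alpha <= #|HH n|%:R) ->
  (forall n, 0 < theta n) ->
  (forall n, kappa * signal_level R n (G1 n) (HH n) < theta n) ->
  \forall n \near \oo,
    witness_risk n kappa (theta n) (G1 n) (HH n) <= alpha.
Proof.
exists 48 => // kappa kappa48 alpha /andP[a0 a1] d G1 HH theta G1n0 G1ne wit HHr Ln HHa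
  theta0 theta_s.
have Ln' : \forall n \near \oo, ln (#|HH n|%:R : R) / n%:R < 1 / 200.
  by apply: (cvgr_lt _ Ln); lra.
near=> n.
have n0 : (0 < n)%N by near: n; exact: nbhs_infty_gt.
have N1 : (1 < #|HH n|)%N.
  rewrite -(ltr1n R); apply: lt_le_trans (HHa n).
  by rewrite ltr_pdivlMr //; lra.
have r0 : (0 < min_arboricity (G1 n))%N.
  have /finset.set0Pn[G GG1] := G1n0 n.
  apply: (min_over_gt0 GG1) => G' G'G1; apply: arboricity_gt0.
  apply: contraNneq (G1ne n) => G'0; suff -> : empty_graph (d n) = G' by [].
  exact/val_inj/esym.
(* Each of the two errors is at most [#|HH n|%:R^-1], hence takes half of [alpha]. *)
have Na : #|HH n|%:R^-1 <= alpha / 2.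
  rewrite -[alpha / 2]invrK lef_pV2 ?posrE ?invr_gt0 ?divr_gt0 ?ltr0n ?(ltnW N1) //.
  by rewrite invf_div.
have t1 : prob (0 : 'M[R]_(d n)) (@witness_test R (d n) n kappa (G1 n) (HH n)) <=
    #|HH n|%:R^-1.
  apply: (type1_error_le kappa48 n0 N1 r0 (HHr n)).
  by apply: ltW; near: n.
rewrite /witness_risk; set B := (X in sup X).
have t2 : sup B <= #|HH n|%:R^-1.
  (* An upper bound controls [sup] only on a nonempty set; on the empty one [sup] is 0. *)
  have [B0|/set0P[b Bb]] := eqVneq B set0; last first.
    apply: ge_sup; first by exists b.
    move=> _ [T hT <-]; apply: (type2_error_le _ n0 N1 r0 (wit n) (HHr n) (theta0 n) (theta_s n) hT).
    by lra.
  by rewrite B0 sup0 invr_ge0.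
lra.
Unshelve. all: by end_near.
Qed.
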